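(* Let $k>0$ be an integer, and let $E:\mathbb{R}\to\mathbb{R}_{\ge0}$ be a function such that $|\mathrm{rd}(x)-x|\le\epsilon\,E(x)$ for all $x$. Suppose that for all $x$, $E$ is piecewise linear on $[\lfloor x\rfloor,\lceil x\rceil]$ with maximum slope $m$. Let $a<b$ be real numbers. Then: (i) If $\mathrm{rd}:\mathbb{R}\to\mathbb{F}$ is `round to nearest', then for $\beta=1/(1-m\epsilon)$, $$\left|\int_a^b|\mathrm{err}(x)|^k\,dx\right|\le\left[\frac{1}{k+1}\int_a^bE(x)^k\,dx\right]\epsilon^k+\left[\frac{2}{k+1}\Bigl((\beta E(a))^{k+1}+(\beta E(b))^{k+1}\Bigr)\right]\epsilon^{k+1}.$$ (ii) If $\mathrm{rd}:\mathbb{R}\to\mathbb{F}$ is `stochastic rounding', then $$\left|\int_a^b\mathbb{E}_{\mathrm{rd}}\bigl[|\mathrm{err}(x)|^k\bigr]\,dx\right|\le\left[\frac{2}{k^2+3k+2}\int_a^bE(x)^k\,dx\right]\epsilon^k+\left[\frac{2}{k^2+3k+2}\Bigl(E(a)^{k+1}+E(b)^{k+1}\Bigr)\right]\epsilon^{k+1}.$$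
   Context: $\mathbb{F}\subset\mathbb{R}$ denotes a discrete set with $\inf\{|x-y|:x,y\in\mathbb{F},x\ne y\}>0$, such that for every $x\in\mathbb{R}$ the quantities $\lceil x\rceil:=\min\{z\in\mathbb{F}:z\ge x\}$ and $\lfloor x\rfloor:=\max\{z\in\mathbb{F}:z\le x\}$ are well defined. Rounding functions. `Round to nearest': $\mathrm{rd}(x)=\lfloor x\rfloor$ if $x\le\frac12(\lfloor x\rfloor+\lceil x\rceil)$ and $\mathrm{rd}(x)=\lceil x\rceil$ otherwise. `Stochastic rounding': $\mathrm{rd}(x)$ is random, equal to $\lceil x\rceil$ with probability $(x-\lfloor x\rfloor)/(\lceil x\rceil-\lfloor x\rfloor)$ and to $\lfloor x\rfloor$ with the complementary probability (and $\mathrm{rd}(x)=x$ for $x\in\mathbb{F}$). The error function is $\mathrm{err}(x):=\mathrm{rd}(x)-x$, and $\mathbb{E}_{\mathrm{rd}}$ denotes expectation over the randomness of the rounding for fixed $x$. Here $\epsilon>0$, and in the stochastic case the bound $|\mathrm{rd}(x)-x|\le\epsilon E(x)$ is for every value that $\mathrm{rd}(x)$ takes with positive probability.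
   Formalization: Part (i) is stated for mε<1 (β is undefined at mε=1 and the bound can fail beyond it), and ''piecewise linear'' means that E is affine on each interval [⌊x⌋,⌈x⌉], with slope at most m; with breakpoints inside such an interval both bounds can fail. *)

(* Defs.v *)
From mathcomp Require Export all_boot all_order all_algebra.
From mathcomp Require Export all_classical all_reals all_analysis.
Import Order.TTheory GRing.Theory Num.Theory.

Set Implicit Arguments.
Unset Strict Implicit.
Unset Printing Implicit Defensive.

Local Open Scope classical_set_scope.
Local Open Scope ring_scope.

Section Rounding.
Context {R : realType}.
Implicit Types (F : set R) (E : R -> R) (x m eps : R).

Definition is_min (A : set R) (z : R) : Prop := A z /\ lbound A z.
Definition is_max (A : set R) (z : R) : Prop := A z /\ ubound A z.

(* The default value 0 is only returned when the minimum (resp. maximum) does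
   not exist, which [rounding_set] excludes. *)
Definition rd_up F x : R := xget 0 (is_min [set z | F z /\ x <= z]).
Definition rd_down F x : R := xget 0 (is_max [set z | F z /\ z <= x]).

Definition gaps F : set R :=
  [set g | exists x y, [/\ F x, F y, x != y & g = `|x - y|]].

Definition rounding_set F : Prop :=
  [/\ 0 < inf (gaps F),
      forall x, exists z, is_min [set z | F z /\ x <= z] z
    & forall x, exists z, is_max [set z | F z /\ z <= x] z].

Definition round_nearest F x : R :=
  if x <= (rd_down F x + rd_up F x) / 2 then rd_down F x else rd_up F x.

(* All the randomness lives on one probability space; no joint law of the
   [rd x] for different [x] is prescribed. *)
Definition stochastic_rounding F d (Omega : measurableType d)
    (P : probability Omega R) (rd : R -> {RV P >-> R}) : Prop :=
  forall x,
    (F x -> P [set w | rd x w = x] = 1%E) /\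
    (~ F x ->
       let p := (x - rd_down F x) / (rd_up F x - rd_down F x) in
       P [set w | rd x w = rd_up F x] = p%:E /\
       P [set w | rd x w = rd_down F x] = (1 - p)%:E).

(* Piecewise linear, the pieces being the closed intervals between consecutive
   points of F: on each of them E is a single affine function, whose (signed)
   slope is at most m.  When x is in F the interval is the point {x}. *)
Definition piecewise_linear_on F E m : Prop :=
  forall x, exists s c : R, s <= m /\
    forall y, rd_down F x <= y <= rd_up F x -> E y = s * y + c.

End Rounding.

(* Main.v *)
(* Split [a, b] into cells, the intervals between consecutive points of F. On a
   full cell of length h the integral of the k-th error moment is explicit:
   2 (h/2)^(k+1) / (k+1) for round to nearest, 2 h^(k+1) / ((k+1)(k+2)) for
   stochastic rounding. Since eps E is affine on the cell, at least h/2 at the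
   midpoint in the first case and at least h everywhere in the second, the
   integral of (eps E)^k is at least 2 (h/2)^(k+1), by convexity, respectively
   h^(k+1). Only the two cells cut by a and b remain, and there the cell length
   is controlled by E a and E b; the factor beta accounts for an increase of E
   between the cut point and the midpoint. When E decreases towards b no such
   control holds, but then the integral of E^k over the kept part of the cell
   compensates, as the discarded part is at most (u - b) E(b)^k. *)
Require Import Defs.
From mathcomp Require Import measurable_realfun zify ring lra.
Import Order.TTheory GRing.Theory Num.Theory.
Import numFieldNormedType.Exports.
Local Open Scope classical_set_scope.
Local Open Scope ring_scope.

(** * Integration and comparison of polynomials through antiderivatives *)

Section PolynomialIntegrals.
Context {R : realType}.
Implicit Types (p q P Q : {poly R}) (f g : R -> R) (a b c x y : R) (k n : nat).
Notation mu := (@lebesgue_measure R).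

Lemma measurable_fun_poly p a b f :
  (forall x, a <= x <= b -> f x = p.[x]) ->
  measurable_fun `[a, b] (EFin \o f).
Proof.
move=> fp; apply: (@eq_measurable_fun _ _ _ _ _ (EFin \o horner p)).
  by move=> x; rewrite inE/= in_itv/= => /fp ->.
apply/measurable_EFinP; apply: measurable_funTS.
by apply: continuous_measurable_fun; exact: continuous_horner.
Qed.

(** The fundamental theorem of calculus, with [a = b] treated apart. Agreement with a polynomial is
    asked on [[a, b]] only, since the integrands below are polynomial piece by piece. *)
Lemma integral_poly P a b f : a <= b ->
  (forall x, a <= x <= b -> f x = P^`().[x]) ->
  (\int[mu]_(x in `[a, b]) (f x)%:E = (P.[b] - P.[a])%:E)%E.
Proof.
move=> ab fP.
transitivity (\int[mu]_(x in `[a, b]) (P^`().[x])%:E)%E.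
  by apply: eq_integral => x; rewrite inE/= in_itv/= => /fP ->.
move: ab; rewrite le_eqVlt => /predU1P[->|ab].
  by rewrite set_itv1 integral_set1 subrr.
rewrite (@continuous_FTC2 _ (horner P^`()) (horner P))//.
- by apply: continuous_subspaceT; exact: continuous_horner.
- split.
  + by move=> x _; exact: derivable_horner.
  + by apply: cvg_at_right_filter; exact: continuous_horner.
  + by apply: cvg_at_left_filter; exact: continuous_horner.
- by move=> x _; rewrite derive1E; apply: derive_val.
Qed.

(** Coefficientwise construction: for a power of [s *: 'X + c%:P] the usual closed form would divide
    by [s], which may vanish. *)
Lemma poly_antiderivative p : exists P, P^`() = p.
Proof.
exists (\sum_(i < size p) (p`_i / i.+1%:R) *: 'X^(i.+1)).
apply/polyP => j; rewrite coef_deriv coef_sum.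
have [js|js] := ltnP j (size p).
  rewrite (bigD1 (Ordinal js))//= big1 ?addr0 => [|i /negPf ij].
    by rewrite coefZ coefXn eqxx mulr1 -[_ *+ j.+1]mulr_natr divfK// pnatr_eq0.
  rewrite coefZ coefXn eqSS; case: eqP => [ji|]; last by rewrite mulr0.
  by move: ij; rewrite -val_eqE/= ji eqxx.
rewrite [RHS]nth_default// big1 ?mul0rn// => i _.
rewrite coefZ coefXn eqSS; case: eqP => [ji|]; last by rewrite mulr0.
by move: (ltn_ord i); rewrite -ji ltnNge js.
Qed.

(** The derivative of [Q - P] is nonnegative, hence so is its integral. This turns later comparisons
    of integrals into pointwise ones. *)
Lemma ler_deriv_poly P Q a b : a <= b ->
  (forall x, a <= x <= b -> P^`().[x] <= Q^`().[x]) ->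
  P.[b] - P.[a] <= Q.[b] - Q.[a].
Proof.
move=> ab PQ; rewrite -subr_ge0.
have -> : Q.[b] - Q.[a] - (P.[b] - P.[a]) = (Q - P).[b] - (Q - P).[a].
  by rewrite !hornerE; ring.
rewrite -lee_fin -(@integral_poly (Q - P) a b (horner (Q - P)^`()))//.
apply: integral_ge0 => x /=; rewrite in_itv/= => /PQ h.
by rewrite lee_fin derivB !hornerE subr_ge0.
Qed.

(** Convexity of the power. In the induction, multiplying the tangent inequality for [k] by [y]
    leaves the surplus [(k + 1) x^k (y - x)^2]. *)
Lemma ge_tangent k x y : 0 <= x -> 0 <= y ->
  x ^+ k.+1 + k.+1%:R * x ^+ k * (y - x) <= y ^+ k.+1.
Proof.
move=> x0 y0; elim: k => [|k IH]; first by rewrite !expr1 expr0; lra.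
apply: (@le_trans _ _ (y * (x ^+ k.+1 + k.+1%:R * x ^+ k * (y - x)))).
  rewrite -subr_ge0.
  have -> : y * (x ^+ k.+1 + k.+1%:R * x ^+ k * (y - x)) -
    (x ^+ k.+2 + k.+2%:R * x ^+ k.+1 * (y - x)) = k.+1%:R * x ^+ k * (y - x) ^+ 2.
    by rewrite -(natr1 k.+1) (exprS x k.+1) (exprS x k); ring.
  by rewrite mulr_ge0 ?sqr_ge0// mulr_ge0// exprn_ge0.
by rewrite [leRHS]exprS ler_wpM2l.
Qed.

(* Jensen's inequality, by comparison with the tangent line at the midpoint. *)
Lemma midpoint_power_le P s c a b k :
  P^`() = (s *: 'X + c%:P) ^+ k.+1 -> a <= b ->
  (forall x, a <= x <= b -> 0 <= s * x + c) ->
  (b - a) * (s * ((a + b) / 2) + c) ^+ k.+1 <= P.[b] - P.[a].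
Proof.
move=> dP ab pos; set z := (a + b) / 2; set v := s * z + c.
have v0 : 0 <= v by apply: pos; rewrite /z; lra.
(* [Q] is an antiderivative of the tangent line at [z]; its quadratic term takes equal values at [a]
   and [b]. *)
pose Q : {poly R} := v ^+ k.+1 *: 'X +
   (k.+1%:R * v ^+ k * s / 2) *: (('X - z%:P) * ('X - z%:P)).
have -> : (b - a) * v ^+ k.+1 = Q.[b] - Q.[a].
  by rewrite /Q !(hornerD, hornerM, hornerN, hornerZ, hornerX, hornerC) /z; field.
apply: ler_deriv_poly => // x xab.
have -> : Q^`().[x] = v ^+ k.+1 + k.+1%:R * v ^+ k * s * (x - z).
  rewrite /Q derivD !derivZ derivX derivM derivXsubC.
  rewrite !(hornerD, hornerM, hornerN, hornerZ, hornerX, hornerC).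
  by field.
rewrite dP !(hornerD, hornerM, hornerZ, hornerX, hornerC, horner_exp).
apply: le_trans _ (ge_tangent k _ _ v0 (pos _ xab)).
by rewrite /v le_eqVlt; apply/orP; left; apply/eqP; ring.
Qed.

End PolynomialIntegrals.

(** * Rounding and the cells between consecutive points of [F] *)

Section Cells.
Context {R : realType}.
Variable F : set R.
Hypothesis hF : rounding_set F.
Implicit Types (l u x y z : R).
Notation mu := (@lebesgue_measure R).

Definition cell l u :=
  [/\ F l, F u, l < u & forall z, F z -> l < z -> u <= z].

Lemma rd_upP x :
  [/\ F (rd_up F x), x <= rd_up F x & forall z, F z -> x <= z -> rd_up F x <= z].
Proof.
case: hF => _ up _; have [[Fz xz] lb] := xgetPex 0 (up x).
by split=> // z Fz' xz'; apply: lb.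
Qed.

Lemma rd_downP x :
  [/\ F (rd_down F x), rd_down F x <= x & forall z, F z -> z <= x -> z <= rd_down F x].
Proof.
case: hF => _ _ down; have [[Fz xz] lb] := xgetPex 0 (down x).
by split=> // z Fz' xz'; apply: lb.
Qed.

Lemma rd_up_id x : F x -> rd_up F x = x.
Proof.
by move=> Fx; have [_ h1 h2] := rd_upP x; apply/eqP; rewrite eq_le h1 h2.
Qed.

Lemma rd_down_id x : F x -> rd_down F x = x.
Proof.
by move=> Fx; have [_ h1 h2] := rd_downP x; apply/eqP; rewrite eq_le h1 h2.
Qed.

Lemma cell_rd_down l u x : cell l u -> l <= x < u -> rd_down F x = l.
Proof.
case=> Fl Fu lu nx /andP[lx xu]; have [Fd dx h] := rd_downP x.
apply/eqP; rewrite eq_le h// andbT leNgt; apply/negP => /(nx _ Fd).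
by move=> /(lt_le_trans xu); rewrite ltNge dx.
Qed.

Lemma cell_rd_up l u x : cell l u -> l < x <= u -> rd_up F x = u.
Proof.
case=> Fl Fu lu nx /andP[lx xu]; have [Fd dx h] := rd_upP x.
by apply/eqP; rewrite eq_le h//= nx// (lt_le_trans lx).
Qed.

Lemma cell_notin l u x : cell l u -> l < x < u -> ~ F x.
Proof.
by case=> _ _ _ nx /andP[lx xu] /nx => /(_ lx); rewrite leNgt xu.
Qed.

Lemma rd_bounds x : ~ F x -> rd_down F x < x < rd_up F x.
Proof.
move=> Fx; have [Fd dx h] := rd_downP x; have [Fu ux h'] := rd_upP x.
rewrite !lt_neqAle dx ux !andbT; apply/andP; split; apply/eqP => e; apply: Fx.
  by rewrite -e.
by rewrite e.
Qed.

Lemma cell_rd x : ~ F x -> cell (rd_down F x) (rd_up F x).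
Proof.
move=> Fx; have [Fd dx h] := rd_downP x; have [Fu ux h'] := rd_upP x.
have /andP[lx xu] := rd_bounds _ Fx.
split=> //; first exact: lt_trans xu.
move=> z Fz dz; apply: h' => //; rewrite leNgt; apply/negP => zx.
by have := h _ Fz (ltW zx); rewrite leNgt dz.
Qed.

(** The midpoint lies strictly inside the cell, so the affine piece attached to it covers the whole
    closed cell. *)
Lemma cell_affine (E : R -> R) m l u : piecewise_linear_on F E m -> cell l u ->
  exists s c, s <= m /\ forall y, l <= y <= u -> E y = s * y + c.
Proof.
move=> /(_ ((l + u) / 2)) [s [c [sm Ey]]] clu; exists s, c; split=> // y.
have lu : l < u by case: clu.
by move: Ey; rewrite (cell_rd_down _ _ _ clu) ?(cell_rd_up _ _ _ clu); [exact|lra|lra].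
Qed.

Lemma gap_le y z : F y -> F z -> y < z -> inf (gaps F) <= z - y.
Proof.
move=> Fy Fz yz; apply: ge_inf.
  by exists 0 => _ [a [b [_ _ _ ->]]].
exists z, y; split=> //; first by rewrite gt_eqF.
by rewrite ger0_norm// subr_ge0 ltW.
Qed.

(** Points of [F] beyond [l] lie at distance at least [d = inf (gaps F)], so rounding [l + d / 2] up
    skips none of them. *)
Lemma cell_next l : F l -> exists2 u, cell l u & l + inf (gaps F) <= u.
Proof.
move=> Fl; have d0 : 0 < inf (gaps F) by case: hF.
set d := inf (gaps F) in d0 *; pose x := l + d / 2.
have [Fu xu h] := rd_upP x.
have lu : l < rd_up F x by rewrite /x in xu *; lra.
exists (rd_up F x); last by have := gap_le _ _ Fl Fu lu; rewrite -/d; lra.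
split=> // z Fz lz; apply: h => //.
by have := gap_le _ _ Fl Fz lz; rewrite -/d /x; lra.
Qed.

Lemma cell_chain (Q : R -> R -> Prop) : (forall z, F z -> Q z z) ->
  (forall l u z, cell l u -> F z -> u <= z -> Q u z -> Q l z) ->
  forall y z, F y -> F z -> y <= z -> Q y z.
Proof.
move=> Q0 Q1 y z Fy Fz yz; have d0 : 0 < inf (gaps F) by case: hF.
(* [n] bounds the number of cells between [y] and [z]: removing the first cell shortens the distance
   by at least [inf (gaps F)]. *)
have [n] : exists n, z - y < n%:R * inf (gaps F).
  exists (Num.bound ((z - y) / inf (gaps F))).
  rewrite -ltr_pdivrMr// archi_boundP// divr_ge0// ?subr_ge0//.
  exact: ltW.
elim: n y Fy yz => [|n IH] y Fy yz; first by rewrite mul0r; lra.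
move: yz; rewrite le_eqVlt => /predU1P[->|yz zyn]; first by move=> _; exact: Q0.
have [u cyu yu] := cell_next _ Fy.
have [_ Fu _ h] := cyu; have uz := h _ Fz yz.
apply: (Q1 _ _ _ cyu Fz uz); apply: IH => //.
by move: zyn; rewrite -natr1 mulrDl mul1r; lra.
Qed.

(** * From estimates on cells to an estimate on [[a, b]] *)

Section Cover.
Local Open Scope ereal_scope.
Variables f g : R -> R.
Hypotheses (f0 : forall x, (0 <= f x)%R) (g0 : forall x, (0 <= g x)%R).
Local Notation I h a b := (\int[mu]_(x in `[a, b]) (h x)%:E).
Local Notation M h a b := (measurable_fun (`[a, b]%classic : set R) (EFin \o h)).

Lemma measurable_fun_itv_cat (h : R -> R) (a c b : R) :
  (a <= c <= b)%R -> M h a c -> M h c b -> M h a b.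
Proof.
move=> /andP[ac cb] m1 m2.
rewrite (@itv_bndbnd_setU _ _ _ (BRight c)) ?bnd_simp//.
apply/measurable_funU => //; split=> //.
apply: measurable_funS m2 => //; apply: subset_itv; by rewrite bnd_simp.
Qed.

(** The common point [c] is dropped from the second interval, which makes the union disjoint and
    does not change the integral. *)
Lemma ge0_integral_itv_cat (h : R -> R) (a c b : R) : (forall x, (0 <= h x)%R) ->
  (a <= c <= b)%R -> M h a c -> M h c b -> I h a b = I h a c + I h c b.
Proof.
move=> h0 acb m1 m2; have /andP[ac cb] := acb.
have m := measurable_fun_itv_cat _ _ _ _ acb m1 m2.
have mo : measurable_fun `]c, b] (EFin \o h).
  by apply: measurable_funS m2 => //; apply: subset_itv; rewrite bnd_simp.
rewrite -(@integral_itv_obnd_cbnd _ c (BRight b) (EFin \o h))//.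
move: m; rewrite (@itv_bndbnd_setU _ _ _ (BRight c) (BRight b)) ?bnd_simp// => m.
rewrite ge0_integral_setU//=.
- by move=> x _; rewrite lee_fin.
- apply/disj_setPS => x [] /=; rewrite !in_itv/= => /andP[_ xc] /andP[cx _].
  by move: xc; rewrite leNgt cx.
Qed.

Lemma ge0_integral_itv_le (h : R -> R) (a b c d : R) : (forall x, (0 <= h x)%R) ->
  (a <= c)%R -> (d <= b)%R -> M h a b -> I h c d <= I h a b.
Proof.
move=> h0 ac db mh; apply: ge0_subset_integral => //.
- by move=> x _; rewrite lee_fin.
- by apply: subset_itv; rewrite bnd_simp.
Qed.

Lemma measurable_fun_itv_sub (h : R -> R) (a b c d : R) :
  (a <= c)%R -> (d <= b)%R -> M h a b -> M h c d.
Proof.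
move=> ac db mh; apply: measurable_funS mh => //.
by apply: subset_itv; rewrite bnd_simp.
Qed.

Hypotheses (mf : forall l u, cell l u -> M f l u)
           (mg : forall l u, cell l u -> M g l u).
Variable C : R.
Hypothesis C0 : (0 <= C)%R.
Hypothesis fullP : forall l u, cell l u -> I g l u <= C%:E * I f l u.

(** Induction along the chain of cells. Measurability is carried along because additivity of the
    integral requires it at each step. *)
Lemma cells_integral_le (y z : R) : F y -> F z -> (y <= z)%R ->
  [/\ M f y z, M g y z & I g y z <= C%:E * I f y z].
Proof.
move: y z; apply: (cell_chain
  (fun y z => [/\ M f y z, M g y z & I g y z <= C%:E * I f y z])).
  move=> z _.
  rewrite set_itv1; split; [exact: measurable_fun_set1|exact: measurable_fun_set1|].
  by rewrite !integral_set1 mule0.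
move=> l u z clu Fz uz [mfz mgz IH].
have luz : (l <= u <= z)%R by case: clu => _ _ /ltW -> _.
have mfl := mf _ _ clu; have mgl := mg _ _ clu.
split; [exact: measurable_fun_itv_cat luz _ _|exact: measurable_fun_itv_cat luz _ _|].
rewrite (ge0_integral_itv_cat _ _ u)// (ge0_integral_itv_cat f _ u)//.
rewrite ge0_muleDr ?lee_fin//; first by apply: leeD => //; exact: fullP.
all: by apply: integral_ge0 => x _; rewrite lee_fin.
Qed.

Variables (a b A B : R).
Hypotheses (ab : (a <= b)%R) (A0 : (0 <= A)%R) (B0 : (0 <= B)%R).
Hypothesis leftP : forall l u, cell l u -> (l < a < u)%R -> I g a u <= A%:E.
Hypothesis rightP : forall l u, cell l u -> (l < b < u)%R ->
  I g l b <= C%:E * I f l b + B%:E.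

(** Rounding [a] up and [b] down cuts [[a, b]] into a left remainder, full cells and a right
    remainder. Below, [f] is [E ^+ k] and [g] the error moment; only the right remainder may also
    draw on the integral of [f]. *)
Lemma cover_integral_le : I g a b <= C%:E * I f a b + (A + B)%:E.
Proof.
have I0 h c d : (forall x, (0 <= h x)%R) -> 0 <= I h c d.
  by move=> h0; apply: integral_ge0 => x _; rewrite lee_fin.
have [Fu au hu] := rd_upP a; have [Fd db hd] := rd_downP b.
set u := rd_up F a in Fu au hu *; set d := rd_down F b in Fd db hd *.
have [mfa mga ga] : [/\ M f a u, M g a u & I g a u <= A%:E].
  have [Fa|nFa] := pselect (F a).
    rewrite /u rd_up_id// set_itv1 integral_set1 lee_fin.
    by split=> //; exact: measurable_fun_set1.
  have cu := cell_rd _ nFa; have al := rd_bounds _ nFa.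
  have la : (rd_down F a <= a)%R by case/andP: al => /ltW.
  split; [|  |exact: leftP cu al].
    by apply: measurable_fun_itv_sub (mf _ _ cu).
  by apply: measurable_fun_itv_sub (mg _ _ cu).
(* If [b < u], then [[a, b]] lies inside the left remainder [[a, u]], and [A] alone suffices. *)
have [bu|ub] := ltP b u.
  have [Fa|nFa] := pselect (F a); first by move: bu; rewrite /u rd_up_id// ltNge ab.
  apply: (@le_trans _ _ A%:E).
    by apply: le_trans ga; apply: ge0_integral_itv_le => //; exact: ltW.
  rewrite -[leLHS]add0e leeD ?lee_fin ?lerDl// mule_ge0 ?lee_fin//; exact: I0.
have [mfb mgb gb] : [/\ M f d b, M g d b & I g d b <= C%:E * I f d b + B%:E].
  have [Fb|nFb] := pselect (F b).
    rewrite /d rd_down_id// set_itv1 !integral_set1 mule0 add0e lee_fin.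
    by split=> //; exact: measurable_fun_set1.
  have cu := cell_rd _ nFb; have bl := rd_bounds _ nFb.
  have lb : (b <= rd_up F b)%R by case/andP: bl => _ /ltW.
  split; [|  |exact: rightP cu bl].
    by apply: measurable_fun_itv_sub (mf _ _ cu).
  by apply: measurable_fun_itv_sub (mg _ _ cu).
have ud : (u <= d)%R by exact: hd.
have [mfd mgd gd] := cells_integral_le _ _ Fu Fd ud.
have udb : (u <= d <= b)%R by rewrite ud.
have aub : (a <= u <= b)%R by rewrite au.
have mfub := measurable_fun_itv_cat _ _ _ _ udb mfd mfb.
have mgub := measurable_fun_itv_cat _ _ _ _ udb mgd mgb.
rewrite (ge0_integral_itv_cat g _ u)// (ge0_integral_itv_cat g u d)//.
apply: (@le_trans _ _ (A%:E + (C%:E * I f u d + (C%:E * I f d b + B%:E)))).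
  by rewrite leeD// leeD.
apply: (@le_trans _ _ (C%:E * I f u b + (A + B)%:E)).
  rewrite (ge0_integral_itv_cat f u d b)// (@ge0_muleDr _ _ (I f u d) (I f d b)) ?I0//.
  by rewrite EFinD [leRHS]addeACA [leLHS]addeA (addeC A%:E).
(* The integral of [f] over [[u, b]] is enlarged to [[a, b]]. *)
rewrite leeD// lee_wpmul2l ?lee_fin//.
apply: ge0_integral_itv_le => //.
exact: measurable_fun_itv_cat aub mfa mfub.
Qed.
End Cover.
End Cells.

(** * Integrals of powers of affine functions *)

Section PowerIntegrals.
Context {R : realType}.
Implicit Types (f : R -> R) (a b c x : R) (k : nat).
Notation mu := (@lebesgue_measure R).

Lemma deriv_powerl k c x :
  (k.+1%:R^-1 *: ('X - c%:P) ^+ k.+1)^`().[x] = (x - c) ^+ k.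
Proof.
rewrite derivZ deriv_exp derivXsubC mul1r hornerZ hornerMn horner_exp hornerXsubC.
by rewrite -[X in _ * X]mulr_natl mulKf// pnatr_eq0.
Qed.

Lemma deriv_powerr k c x :
  (- k.+1%:R^-1 *: (c%:P - 'X) ^+ k.+1)^`().[x] = (c - x) ^+ k.
Proof.
rewrite derivZ deriv_exp derivB derivX derivC sub0r mulN1r.
rewrite hornerZ hornerMn hornerN horner_exp hornerD hornerN hornerX hornerC.
by rewrite mulNrn mulrNN -[X in _ * X]mulr_natl mulKf// pnatr_eq0.
Qed.

Lemma integral_powerl k c a b f : a <= b ->
  (forall x, a <= x <= b -> f x = (x - c) ^+ k) ->
  measurable_fun `[a, b] (EFin \o f) /\
  (\int[mu]_(x in `[a, b]) (f x)%:E =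
    (((b - c) ^+ k.+1 - (a - c) ^+ k.+1) / k.+1%:R)%:E)%E.
Proof.
move=> ab fx; set P := k.+1%:R^-1 *: ('X - c%:P) ^+ k.+1.
have fP x : a <= x <= b -> f x = P^`().[x].
  by move=> /fx ->; rewrite /P deriv_powerl.
split; first exact: measurable_fun_poly fP.
rewrite (integral_poly P)//; congr EFin.
by rewrite /P !(hornerZ, horner_exp, hornerXsubC) -mulrBr mulrC.
Qed.

Lemma integral_powerr k c a b f : a <= b ->
  (forall x, a <= x <= b -> f x = (c - x) ^+ k) ->
  measurable_fun `[a, b] (EFin \o f) /\
  (\int[mu]_(x in `[a, b]) (f x)%:E =
    (((c - a) ^+ k.+1 - (c - b) ^+ k.+1) / k.+1%:R)%:E)%E.
Proof.
move=> ab fx; set P := - k.+1%:R^-1 *: (c%:P - 'X) ^+ k.+1.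
have fP x : a <= x <= b -> f x = P^`().[x].
  by move=> /fx ->; rewrite /P deriv_powerr.
split; first exact: measurable_fun_poly fP.
rewrite (integral_poly P)//; congr EFin.
rewrite /P !(hornerZ, horner_exp, hornerD, hornerN, hornerX, hornerC).
by rewrite -mulrBr mulNr -mulrN opprB mulrC.
Qed.

(** One antiderivative [P] serves all subintervals of the cell, so that increments over adjacent
    pieces can be added and compared. *)
Lemma integral_affine_power k (s c : R) f l u :
  (forall x, l <= x <= u -> f x = s * x + c) ->
  exists P : {poly R}, [/\ P^`() = (s *: 'X + c%:P) ^+ k,
    measurable_fun `[l, u] (EFin \o (fun x => f x ^+ k)) &
    forall a b, l <= a -> a <= b -> b <= u ->
      (\int[mu]_(x in `[a, b]) (f x ^+ k)%:E = (P.[b] - P.[a])%:E)%E].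
Proof.
move=> fx; have [P dP] := poly_antiderivative ((s *: 'X + c%:P) ^+ k).
have fP x : l <= x <= u -> f x ^+ k = P^`().[x].
  by move=> /fx ->; rewrite dP !(hornerD, hornerZ, horner_exp, hornerX, hornerC).
exists P; split=> //.
  exact: (measurable_fun_poly P^`() l u (fun x => f x ^+ k) fP).
move=> a b la ab bu; apply: (integral_poly P a b (fun x => f x ^+ k)) => // x.
by move=> /andP[ax xb]; apply: fP; rewrite (le_trans la)// (le_trans xb).
Qed.

End PowerIntegrals.

(** * Sign of the slope bound *)

Section Slope.
Context {R : realType}.
Variables (F : set R) (E : R -> R) (m : R).
Hypotheses (hF : rounding_set F) (E0 : forall x, 0 <= E x).
Hypothesis hE : piecewise_linear_on F E m.

(* [F] is unbounded above, so a negative bound on the slopes would eventually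
   force [E] below zero. *)
Lemma slope_bound_ge0 : 0 <= m.
Proof.
have growth y z : F y -> F z -> y <= z -> E z <= E y + m * (z - y).
  move: y z; apply: (cell_chain _ hF (fun y z => E z <= E y + m * (z - y))).
    by move=> z _; rewrite subrr mulr0 addr0.
  move=> l u z clu Fz uz IH; have [_ _ lu _] := clu.
  have [s [c [sm Ey]]] := cell_affine _ hF _ _ _ _ hE clu.
  apply: le_trans IH _.
  rewrite (Ey l) ?(Ey u); [|lra..].
  have : s * (u - l) <= m * (u - l) by rewrite ler_wpM2r// subr_ge0 ltW.
  by rewrite !mulrBr; lra.
rewrite leNgt; apply/negP => m0.
have [Fy _ _] := rd_upP _ hF 0; set y := rd_up F 0 in Fy.
(* Over the distance [(E y + 1) / - m], a slope at most [m] brings [E] from [E y] down to at most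
   [-1]. *)
have [Fz yz _] := rd_upP _ hF (y + (E y + 1) / - m).
set z := rd_up F _ in Fz yz.
have p : 0 <= (E y + 1) / - m by rewrite divr_ge0// ?addr_ge0// oppr_ge0 ltW.
have yz' : y <= z by lra.
have := growth _ _ Fy Fz yz'; apply/negP; rewrite -ltNge.
apply: lt_le_trans (E0 z).
have : (E y + 1) / - m * - m <= (z - y) * - m.
  by rewrite ler_wpM2r//; [rewrite oppr_ge0 ltW|lra].
by rewrite divfK ?oppr_eq0 ?lt_eqF//; lra.
Qed.

End Slope.

(** * Round to nearest *)

Section Nearest.
Context {R : realType}.
Variables (F : set R) (E : R -> R) (m eps : R) (k : nat).
Hypotheses (hF : rounding_set F) (E0 : forall x, 0 <= E x).
Hypothesis hE : piecewise_linear_on F E m.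
Hypotheses (eps0 : 0 < eps) (k0 : (0 < k)%N).
Hypothesis err_le : forall x, `|round_nearest F x - x| <= eps * E x.
Hypothesis meps1 : m * eps < 1.
Notation mu := (@lebesgue_measure R).
Let beta : R := 1 / (1 - m * eps).
Let g x := `|round_nearest F x - x| ^+ k.
Let N : R := k.+1%:R.

Lemma nearest_err_left l u x : cell F l u -> l <= x <= (l + u) / 2 ->
  `|round_nearest F x - x| = x - l.
Proof.
move=> clu /andP[lx xc]; have [Fl _ lu _] := clu.
move: lx; rewrite le_eqVlt => /predU1P[<-|lx].
  by rewrite /round_nearest rd_up_id// rd_down_id// if_same !subrr normr0.
rewrite /round_nearest (cell_rd_down _ hF _ _ _ clu) ?(cell_rd_up _ hF _ _ _ clu);
  [|lra..].
by rewrite xc distrC ger0_norm// subr_ge0 ltW.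
Qed.

Lemma nearest_err_right l u x : cell F l u -> (l + u) / 2 <= x <= u ->
  `|round_nearest F x - x| = u - x.
Proof.
move=> clu /andP[cx xu]; have [_ Fu lu _] := clu.
move: cx; rewrite le_eqVlt => /predU1P[<-|cx].
  by rewrite (nearest_err_left _ _ _ clu); [field|lra].
move: xu; rewrite le_eqVlt => /predU1P[->|xu].
  by rewrite /round_nearest rd_up_id// rd_down_id// if_same !subrr normr0.
rewrite /round_nearest (cell_rd_down _ hF _ _ _ clu) ?(cell_rd_up _ hF _ _ _ clu);
  [|lra..].
by rewrite leNgt cx/= ger0_norm// subr_ge0 ltW.
Qed.

Local Notation I h a b := (\int[mu]_(x in `[a, b]) (h x)%:E)%E.

Lemma nearest_integral_left l u a b : cell F l u ->
  l <= a -> a <= b -> b <= (l + u) / 2 ->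
  measurable_fun `[a, b] (EFin \o g) /\
  I g a b = (((b - l) ^+ k.+1 - (a - l) ^+ k.+1) / N)%:E.
Proof.
move=> clu la ab bc; apply: integral_powerl => // x /andP[ax xb].
by rewrite /g (nearest_err_left _ _ _ clu)// (le_trans la)// (le_trans xb).
Qed.

Lemma nearest_integral_right l u a b : cell F l u ->
  (l + u) / 2 <= a -> a <= b -> b <= u ->
  measurable_fun `[a, b] (EFin \o g) /\
  I g a b = (((u - a) ^+ k.+1 - (u - b) ^+ k.+1) / N)%:E.
Proof.
move=> clu ca ab bu; apply: integral_powerr => // x /andP[ax xb].
by rewrite /g (nearest_err_right _ _ _ clu)// (le_trans ca)// (le_trans xb).
Qed.

Let g0 x : 0 <= g x. Proof. by rewrite exprn_ge0. Qed.

(** The error is a tent with peak at the midpoint: both halves contribute equally, and the part over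
    [[b, u]] is subtracted. *)
Lemma nearest_integral_from_left l u b : cell F l u ->
  (l + u) / 2 <= b -> b <= u ->
  measurable_fun `[l, b] (EFin \o g) /\
  I g l b = ((2 * ((u - l) / 2) ^+ k.+1 - (u - b) ^+ k.+1) / N)%:E.
Proof.
move=> clu cb bu; have [_ _ lu _] := clu.
have lc : l <= (l + u) / 2 by lra.
have [m1 i1] := nearest_integral_left _ _ _ _ clu (lexx _) lc (lexx _).
have [m2 i2] := nearest_integral_right _ _ _ _ clu (lexx _) cb bu.
have lcb : l <= (l + u) / 2 <= b by rewrite lc.
split; first exact: measurable_fun_itv_cat lcb m1 m2.
rewrite (ge0_integral_itv_cat _ _ _ _ g0 lcb)// i1 i2 -EFinD; congr EFin.
have -> : (l + u) / 2 - l = (u - l) / 2 by field.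
have -> : u - (l + u) / 2 = (u - l) / 2 by field.
by rewrite subrr expr0n/= subr0 -mulrDl; congr (_ / _); ring.
Qed.

Let N0 : 0 < N. Proof. by rewrite ltr0n. Qed.
Let N0' : 0 <= N. Proof. exact: ltW. Qed.
Let eps0' : 0 <= eps. Proof. exact: ltW. Qed.

Lemma nearest_integral_cell l u : cell F l u ->
  measurable_fun `[l, u] (EFin \o g) /\
  I g l u = (2 * ((u - l) / 2) ^+ k.+1 / N)%:E.
Proof.
move=> clu; have [_ _ lu _] := clu.
have [|? ->] := nearest_integral_from_left _ _ u clu _ (lexx _); first lra.
by rewrite subrr expr0n/= subr0.
Qed.

Let half_cell_le l u : cell F l u -> (u - l) / 2 <= eps * E ((l + u) / 2).
Proof.
move=> clu; have [_ _ lu _] := clu.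
apply: le_trans (err_le _); rewrite (nearest_err_left _ _ _ clu); last lra.
by rewrite le_eqVlt; apply/orP; left; apply/eqP; field.
Qed.

(** Jensen's inequality at the midpoint, where the error is exactly half the cell. Stating it
    through [P] allows the increment to be split later at a cut point. *)
Lemma nearest_cell_power_le l u P s c : cell F l u ->
  (forall x, l <= x <= u -> E x = s * x + c) ->
  P^`() = (s *: 'X + c%:P) ^+ k ->
  2 * ((u - l) / 2) ^+ k.+1 <= eps ^+ k * (P.[u] - P.[l]).
Proof.
move=> clu Ey dP; have [_ _ lu _] := clu.
have h0 : 0 <= (u - l) / 2 by lra.
have PE : (u - l) * E ((l + u) / 2) ^+ k <= P.[u] - P.[l].
  rewrite Ey; last lra.
  move: dP; rewrite -(prednK k0) => dP.
  apply: midpoint_power_le dP (ltW lu) _ => x lxu.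
  by rewrite -Ey.
apply: le_trans (ler_wpM2l (exprn_ge0 _ (ltW eps0)) PE).
rewrite mulrCA -exprMn.
have -> : 2 * ((u - l) / 2) ^+ k.+1 = (u - l) * ((u - l) / 2) ^+ k.
  by rewrite exprS; field.
rewrite ler_wpM2l ?lerXn2r ?nnegrE ?half_cell_le//; first lra.
by rewrite mulr_ge0.
Qed.

Lemma nearest_full l u : cell F l u ->
  (I g l u <= (N^-1 * eps ^+ k)%:E * I (fun x => E x ^+ k)%R l u)%E.
Proof.
move=> clu; have [_ _ lu _] := clu.
have [s [c [sm Ey]]] := cell_affine _ hF _ _ _ _ hE clu.
have [P [dP _ iP]] := integral_affine_power k _ _ _ _ _ Ey.
have [_ ->] := nearest_integral_cell _ _ clu.
have [lel leu] := (lexx l, lexx u); have lu' := ltW lu.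
rewrite (iP l u)// -EFinM lee_fin.
rewrite [leLHS]mulrC -[leRHS]mulrA ler_pM2l ?invr_gt0//.
exact: nearest_cell_power_le clu Ey dP.
Qed.

Let beps : 0 < 1 - m * eps. Proof. by rewrite subr_gt0. Qed.

Let bE x := beta * E x * eps.

(** The slope bound [m] is nonnegative, hence [beta] is at least [1]. *)
Let epsE_le x : eps * E x <= bE x.
Proof.
have m0 := slope_bound_ge0 _ _ _ hF E0 hE.
have -> : bE x = beta * (eps * E x) by rewrite /bE; ring.
rewrite ler_peMl ?mulr_ge0//.
rewrite /beta ler_pdivlMr// mul1r gerBl mulr_ge0//.
Qed.

Let bE0 x : 0 <= bE x.
Proof. by apply: le_trans (epsE_le x); rewrite mulr_ge0. Qed.

(** The origin of [beta]: solving for [z] divides by [1 - m * eps]. It is applied with [z] half a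
    cell length. *)
Let le_bE x z : z <= eps * E x + m * eps * z -> z <= bE x.
Proof.
move=> zx; rewrite /bE /beta mul1r mulrAC -mulrA mulrC ler_pdivlMr//.
by rewrite mulrBr mulr1 lerBlDr (mulrC z).
Qed.

Let two_div x : 2 / N * x * N = 2 * x.
Proof. by field; rewrite gt_eqF. Qed.

Lemma nearest_left l u a : cell F l u -> l < a < u ->
  (I g a u <= (2 / N * (beta * E a) ^+ k.+1 * eps ^+ k.+1)%:E)%E.
Proof.
move=> clu /andP[la au]; rewrite -mulrA -exprMn -/(bE a).
have m0 := slope_bound_ge0 _ _ _ hF E0 hE.
have [ac|ca] := leP a ((l + u) / 2).
  apply: (@le_trans _ _ (I g l u)).
    apply: ge0_integral_itv_le => //; first exact: ltW.
    by have [] := nearest_integral_cell _ _ clu.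
  have [_ ->] := nearest_integral_cell _ _ clu.
  rewrite lee_fin mulrAC ler_wpM2l ?divr_ge0//.
  rewrite lerXn2r ?nnegrE//; first lra.
  apply: le_bE; apply: le_trans (half_cell_le _ _ clu) _.
  have [s [c [sm Ey]]] := cell_affine _ hF _ _ _ _ hE clu.
  rewrite !Ey; [|lra..].
  (* From [a] to the midpoint [E] rises by at most [m] times half the cell, which gives the
     self-referential bound for [le_bE]. *)
  have : s * ((l + u) / 2 - a) <= m * ((u - l) / 2).
    apply: (@le_trans _ _ (m * ((l + u) / 2 - a))).
      by rewrite ler_wpM2r// subr_ge0.
    by rewrite ler_wpM2l//; lra.
  move=> /(ler_wpM2l (ltW eps0)); rewrite !mulrDr !mulrN; lra.
(* Beyond the midpoint, [u - a] is the error at [a] itself. *)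
have [_ ->] := nearest_integral_right _ _ _ _ clu (ltW ca) (ltW au) (lexx _).
rewrite lee_fin subrr expr0n/= subr0 ler_pdivrMr// two_div.
have h : (u - a) ^+ k.+1 <= bE a ^+ k.+1.
  rewrite lerXn2r ?nnegrE//; first lra.
  apply: le_trans (epsE_le a); apply: le_trans (err_le a).
  by rewrite (nearest_err_right _ _ _ clu)//; lra.
have := exprn_ge0 k.+1 (bE0 a); lra.
Qed.

(** The constant term alone suffices when [b] is at most the midpoint, or when [E] does not decrease
    on the cell. *)
Lemma nearest_right l u b : cell F l u -> l < b < u ->
  (I g l b <= (N^-1 * eps ^+ k)%:E * I (fun x => E x ^+ k)%R l b
     + (2 / N * (beta * E b) ^+ k.+1 * eps ^+ k.+1)%:E)%E.
Proof.
move=> clu /andP[lb bu]; rewrite -[(2 / N * _ * _)%R]mulrA -exprMn -/(bE b).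
have [s [c [sm Ey]]] := cell_affine _ hF _ _ _ _ hE clu.
have [P [dP _ iP]] := integral_affine_power k _ _ _ _ _ Ey.
have I0 : (0 <= (N^-1 * eps ^+ k)%:E * I (fun x => E x ^+ k)%R l b)%E.
  apply: mule_ge0; first by rewrite lee_fin mulr_ge0// ?exprn_ge0 ?invr_ge0.
  by apply: integral_ge0 => x _; rewrite lee_fin exprn_ge0.
have B0 := exprn_ge0 k.+1 (bE0 b).
have [bc|cb] := leP b ((l + u) / 2).
  rewrite -[leLHS]add0e leeD//.
  have [_ ->] := nearest_integral_left _ _ _ _ clu (lexx _) (ltW lb) bc.
  rewrite lee_fin subrr expr0n/= subr0 ler_pdivrMr// two_div.
  have h : (b - l) ^+ k.+1 <= bE b ^+ k.+1.
    rewrite lerXn2r ?nnegrE//; first lra.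
    apply: le_trans (epsE_le b); apply: le_trans (err_le b).
    by rewrite (nearest_err_left _ _ _ clu)//; lra.
  lra.
have ub_le : u - b <= eps * E b.
  by apply: le_trans (err_le b); rewrite (nearest_err_right _ _ _ clu)//; lra.
(* With a nonnegative slope, [E] at the midpoint is at most [E b], so [eps * E b] bounds the half
   length and the whole cell may be taken. *)
have [s0|s0] := leP 0 s.
  rewrite -[leLHS]add0e leeD//.
  apply: (@le_trans _ _ (I g l u)).
    apply: ge0_integral_itv_le => //; first exact: ltW.
    by have [] := nearest_integral_cell _ _ clu.
  have [_ ->] := nearest_integral_cell _ _ clu.
  rewrite lee_fin mulrAC ler_wpM2l ?divr_ge0//.
  rewrite lerXn2r ?nnegrE//; first lra.
  apply: le_trans (epsE_le b); apply: le_trans (half_cell_le _ _ clu) _.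
  by rewrite ler_pM2l// !Ey ?lerD2r ?ler_wpM2l; lra.
(* Here [E] is decreasing on the cell, and the integral of [E ^+ k] over the
   missing piece [b, u] is at most [(u - b) * E b ^+ k]. *)
have [_ ->] := nearest_integral_from_left _ _ b clu (ltW cb) (ltW bu).
have [lel lb' bu'] := And3 (lexx l) (ltW lb) (ltW bu).
rewrite (iP l b)// -EFinM -EFinD lee_fin.
have full := nearest_cell_power_le _ _ _ _ _ clu Ey dP.
have tail : eps ^+ k * (P.[u] - P.[b]) <= bE b ^+ k.+1.
  apply: (@le_trans _ _ (eps ^+ k * ((u - b) * E b ^+ k))).
    rewrite ler_wpM2l ?exprn_ge0//.
    have -> : (u - b) * E b ^+ k = ((E b ^+ k) *: 'X).[u] - ((E b ^+ k) *: 'X).[b].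
      by rewrite !hornerZ !hornerX; ring.
    apply: ler_deriv_poly => [|x /andP[bx xu]]; first exact: ltW.
    rewrite derivZ derivX hornerZ hornerC mulr1 dP horner_exp.
    rewrite hornerD hornerZ hornerX hornerC -Ey; last lra.
    rewrite lerXn2r ?nnegrE// !Ey; [|lra..].
    by rewrite lerD2r ler_wnM2l// ltW.
  rewrite mulrCA -exprMn exprS.
  have epsE0 : 0 <= eps * E b by rewrite mulr_ge0.
  apply: ler_pM; [lra|exact: exprn_ge0|exact: le_trans (epsE_le b)|].
  by rewrite lerXn2r ?nnegrE.
have t0 : 0 <= (u - b) ^+ k.+1 by rewrite exprn_ge0// subr_ge0 ltW.
rewrite ler_pdivrMr//.
have -> : (N^-1 * eps ^+ k * (P.[b] - P.[l]) + 2 / N * bE b ^+ k.+1) * N =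
    eps ^+ k * (P.[b] - P.[l]) + 2 * bE b ^+ k.+1.
  by field; rewrite gt_eqF.
(* The full-cell bound is split at [b]; its part over [[b, u]] is absorbed by [bE b ^+ k.+1]. *)
move: full tail; rewrite !mulrBr; lra.
Qed.

End Nearest.

(** * Expectations of random variables concentrated on one or two values *)

Section FiniteSupport.
Context d (T : measurableType d) {R : realType} (P : probability T R).
Implicit Types (X : {RV P >-> R}) (f : R -> R) (u v p : R).
Local Open Scope ereal_scope.

Lemma integral_full_event (A : set T) (h : T -> \bar R) : measurable A -> P A = 1 ->
  measurable_fun setT h -> (forall w, 0 <= h w) ->
  \int[P]_w h w = \int[P]_(w in A) h w.
Proof.
move=> mA PA mh h0; have mAc : measurable (~` A) by exact: measurableC.
have PAc : P (~` A) = 0 by rewrite probability_setC// PA subee.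
rewrite -(setUv A) ge0_integral_setU ?setUv//; last exact/disj_setPCl.
rewrite [X in _ + X]null_set_integral ?adde0//.
exact: measurable_funTS.
Qed.

Lemma measurable_event_eq X v : measurable [set w | X w = v].
Proof.
have -> : [set w | X w = v] = X @^-1` [set v] by [].
exact: measurable_funPTI.
Qed.

Lemma integral_event_eq X f v :
  \int[P]_(w in [set w | X w = v]) (f (X w))%:E = (f v)%:E * P [set w | X w = v].
Proof.
rewrite -integral_cst; last exact: measurable_event_eq.
by apply: eq_integral => w; rewrite inE/= => ->.
Qed.

Section Expectation.
Variables (X : {RV P >-> R}) (f : R -> R).
Hypotheses (mf : measurable_fun setT f) (f0 : forall x, (0 <= f x)%R).

Let mfX : measurable_fun setT (fun w => (f (X w))%:E).
Proof. by apply/measurable_EFinP; exact: measurableT_comp. Qed.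

Lemma expectation_dirac v : P [set w | X w = v] = 1 ->
  'E_P[fun w => f (X w)] = (f v)%:E.
Proof.
move=> Pv; rewrite unlock (integral_full_event [set w | X w = v])//=.
- by rewrite integral_event_eq Pv mule1.
- exact: measurable_event_eq.
- by move=> w; rewrite lee_fin.
Qed.

(** Only two probabilities are prescribed; they add up to [1], so any other value is confined to a
    null event. *)
Lemma expectation_two_points u v p : u != v ->
  P [set w | X w = u] = p%:E -> P [set w | X w = v] = (1 - p)%:E ->
  'E_P[fun w => f (X w)] = (p * f u + (1 - p) * f v)%:E.
Proof.
move=> uv Pu Pv.
have mu := measurable_event_eq X u; have mv := measurable_event_eq X v.
have dis : [disjoint [set w | X w = u] & [set w | X w = v]].
  by apply/disj_setPS => w /= [-> /eqP]; rewrite (negPf uv).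
have PU : P ([set w | X w = u] `|` [set w | X w = v]) = 1.
  rewrite (@measureU _ _ _ P _ _ mu mv); last exact/eqP.
  by move: Pu Pv => /= -> ->; rewrite -EFinD addrC subrK.
rewrite unlock (integral_full_event ([set w | X w = u] `|` [set w | X w = v]))//=.
- rewrite ge0_integral_setU//; last 2 first.
  + exact: measurable_funTS.
  + by move=> w _; rewrite lee_fin.
  by rewrite !integral_event_eq Pu Pv -!EFinM -EFinD !(mulrC (f _)).
- exact: measurableU.
- by move=> w; rewrite lee_fin.
Qed.

End Expectation.
End FiniteSupport.

(** Passage to the endpoint: stochastic error bounds are available inside a cell, while at its ends
    the rounding is exact. *)
Lemma affine_ge0_right {R : realType} (s c l u : R) : l < u ->
  (forall x, l < x < u -> 0 <= s * x + c) -> 0 <= s * u + c.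
Proof.
move=> lu h; rewrite leNgt; apply/negP => neg.
have := h ((l + u) / 2); rewrite midf_lt// => hm.
set M := s * ((l + u) / 2) + c in hm.
have M0 : 0 <= M by apply: hm; lra.
set D := - (s * u + c); have D0 : 0 < D by rewrite oppr_gt0.
have MD : 0 < M + D by lra.
(* At weight [t] on the midpoint and [1 - t] on [u] the affine function equals
   [t * (M + D) - D = - D / 2], which is negative. *)
pose t := D / (M + D) / 2.
have tMD : t * (M + D) = D / 2 by rewrite /t mulrAC divfK// gt_eqF.
have t0 : 0 < t by rewrite !divr_gt0.
have t1 : t < 1.
  by rewrite /t -mulrA -invfM ltr_pdivrMr ?mulr_gt0// mul1r; lra.
have : 0 <= s * (t * ((l + u) / 2) + (1 - t) * u) + c.
  apply: h; apply/andP; split.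
    have : 0 < t * ((l + u) / 2 - l) + (1 - t) * (u - l).
      by apply: addr_gt0; apply: mulr_gt0; lra.
    by rewrite !mulrBl !mulrBr; lra.
  have : 0 < t * (u - (l + u) / 2) by apply: mulr_gt0; lra.
  by rewrite !mulrBl !mulrBr; lra.
have -> : s * (t * ((l + u) / 2) + (1 - t) * u) + c = t * (M + D) - D.
  by rewrite /M /D; ring.
by rewrite tMD; lra.
Qed.

Lemma affine_ge0_left {R : realType} (s c l u : R) : l < u ->
  (forall x, l < x < u -> 0 <= s * x + c) -> 0 <= s * l + c.
Proof.
move=> lu h; rewrite -[l]opprK mulrN -mulNr.
apply: (@affine_ge0_right _ _ _ (- u)) => [|x ux]; first by rewrite ltrN2.
by rewrite mulNr -mulrN; apply: h; lra.
Qed.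

(** * Stochastic rounding *)

Section Stochastic.
Context {R : realType}.
Variables (F : set R) (k : nat).
Hypotheses (hF : rounding_set F) (k0 : (0 < k)%N).
Notation mu := (@lebesgue_measure R).
Local Notation I h a b := (\int[mu]_(x in `[a, b]) (h x)%:E)%E.

(* The case [x] in [F] is covered because then [rd_up F x = rd_down F x] and the
   quotient is [0]. *)
Definition stochastic_moment x : R :=
  let p := (x - rd_down F x) / (rd_up F x - rd_down F x) in
  p * (rd_up F x - x) ^+ k + (1 - p) * (x - rd_down F x) ^+ k.

Let g := stochastic_moment.

(** At the endpoints both roundings coincide and both sides vanish, as [0 ^+ k = 0] for positive
    [k]. *)
Lemma stochastic_moment_cell l u x : cell F l u -> l <= x <= u ->
  g x = ((x - l) * (u - x) ^+ k + (u - x) * (x - l) ^+ k) / (u - l).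
Proof.
move=> clu /andP[]; have [Fl Fu lu _] := clu.
have z : (0 : R) ^+ k = 0 by rewrite expr0n gtn_eqF.
have zx y : F y -> g y = 0.
  move=> Fy; rewrite /g /stochastic_moment rd_up_id// rd_down_id//.
  by rewrite !subrr !mul0r z mulr0 addr0.
rewrite le_eqVlt => /predU1P[<- _|lx].
  by rewrite zx// subrr z !mul0r mulr0 addr0 mul0r.
rewrite le_eqVlt => /predU1P[->|xu].
  by rewrite zx// subrr z !mul0r mulr0 addr0 mul0r.
rewrite /g /stochastic_moment.
rewrite (cell_rd_down _ hF _ _ _ clu) ?(cell_rd_up _ hF _ _ _ clu);
  [|lra..].
by field; rewrite subr_eq0 gt_eqF.
Qed.

Let K : R := 2 / (k ^ 2 + 3 * k + 2)%:R.

Lemma stochastic_integral_cell l u : cell F l u ->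
  measurable_fun `[l, u] (EFin \o g) /\ I g l u = (K * (u - l) ^+ k.+1)%:E.
Proof.
move=> clu; have [_ _ lu _] := clu.
pose pl n : {poly R} := n.+1%:R^-1 *: ('X - l%:P) ^+ n.+1.
pose pr n : {poly R} := - n.+1%:R^-1 *: (u%:P - 'X) ^+ n.+1.
(* Writing [x - l] as [(u - l) - (u - x)], and symmetrically [u - x], turns the moment into a
   combination of pure powers. *)
pose Q := pl k + pr k - (u - l)^-1 *: (pl k.+1 + pr k.+1).
have ul : u - l != 0 by rewrite subr_eq0 gt_eqF.
have gQ x : l <= x <= u -> g x = Q^`().[x].
  move=> lxu; rewrite (stochastic_moment_cell _ _ _ clu)// /Q derivB derivZ !derivD.
  rewrite hornerD hornerN hornerZ !hornerD /pl /pr !deriv_powerl !deriv_powerr.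
  by rewrite !exprS; field.
split; first exact: measurable_fun_poly gQ.
rewrite (integral_poly Q)// ?ltW//; congr EFin.
rewrite /Q /pl /pr !(hornerD, hornerN, hornerZ, horner_exp, hornerX, hornerC).
rewrite !subrr !expr0n/= /K.
have -> : (k ^ 2 + 3 * k + 2)%:R = k.+1%:R * k.+2%:R :> R.
  by rewrite -natrM; congr _%:R; lia.
rewrite (exprS _ k.+1) -(natr1 k.+1); field.
by rewrite ul nat1r natr1 !pnatr_eq0.
Qed.

Let K0 : 0 <= K. Proof. by rewrite divr_ge0. Qed.

Lemma stochastic_moment_ge0 x : 0 <= stochastic_moment x.
Proof.
rewrite /stochastic_moment.
have [_ dx _] := rd_downP _ hF x; have [_ ux _] := rd_upP _ hF x.
have [e|ne] := eqVneq (rd_up F x - rd_down F x) 0.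
  by rewrite e invr0 mulr0 mul0r subr0 mul1r add0r exprn_ge0// subr_ge0.
have ne' : 0 < rd_up F x - rd_down F x by rewrite lt_neqAle eq_sym ne; lra.
rewrite addr_ge0// mulr_ge0 ?exprn_ge0 ?subr_ge0 ?divr_ge0//; try lra.
by rewrite ler_pdivrMr// mul1r; lra.
Qed.

Section Expectation.
Context d (Omega : measurableType d) (P : probability Omega R).
Variable rd : R -> {RV P >-> R}.
Hypothesis hrd : stochastic_rounding F rd.

Lemma stochastic_momentE x : ('E_P[fun w => (`|rd x w - x| ^+ k)%R] = (g x)%:E)%E.
Proof.
have mf : measurable_fun setT (fun v : R => `|v - x| ^+ k).
  apply: measurable_funX; apply: measurableT_comp => //.
  exact: measurable_funB.
have f0 (v : R) : 0 <= `|v - x| ^+ k by rewrite exprn_ge0.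
have [Fx nFx] := hrd x; have [xF|xF] := pselect (F x).
  rewrite (expectation_dirac _ _ _ (rd x) _ mf f0 x) ?Fx//.
  rewrite /g /stochastic_moment rd_up_id// rd_down_id// !subrr !mul0r normr0.
  by rewrite expr0n/= gtn_eqF// mulr0 addr0.
have /andP[dx xu] := rd_bounds _ hF _ xF.
have [Pu Pd] := nFx xF.
rewrite (expectation_two_points _ _ _ (rd x) _ mf f0 _ _ _ _ Pu Pd).
  rewrite ger0_norm ?subr_ge0 ?ltW// distrC ger0_norm// subr_ge0 ltW//.
by rewrite gt_eqF// (lt_trans dx).
Qed.

Variables (E : R -> R) (m eps : R).
Hypotheses (E0 : forall x, 0 <= E x) (hE : piecewise_linear_on F E m).
Hypothesis eps0 : 0 < eps.
Hypothesis err_le : forall x v : R, (0 < P [set w | rd x w = v])%E ->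
  `|v - x| <= eps * E x.

(** Strictly inside a cell both neighbours have positive probability, so the error bound applies to
    each. *)
Lemma stochastic_err_le l u x : cell F l u -> l < x < u ->
  x - l <= eps * E x /\ u - x <= eps * E x.
Proof.
move=> clu lxu; have nF := cell_notin _ _ _ _ clu lxu.
have [_ /(_ nF)] := hrd x; have /andP[lx xu] := lxu.
rewrite (cell_rd_down _ hF _ _ _ clu) ?(cell_rd_up _ hF _ _ _ clu);
  [|lra..].
have lu0 : 0 < u - l by lra.
set p := (x - l) / (u - l) => -[Pu Pl].
have p0 : 0 < p by rewrite divr_gt0// subr_gt0.
have p1 : p < 1 by rewrite ltr_pdivrMr// mul1r; lra.
split.
  rewrite -[leLHS]ger0_norm ?subr_ge0 ?(ltW lx)// distrC; apply: err_le.
  by rewrite Pl lte_fin subr_gt0.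
rewrite -[leLHS]ger0_norm ?subr_ge0 ?(ltW xu)//; apply: err_le.
by rewrite Pu lte_fin.
Qed.

(** Letting the point tend to [u] and to [l] in the two error bounds gives the claim at both ends;
    an affine function is smallest at one of them. *)
Lemma stochastic_cell_le l u x : cell F l u -> l <= x <= u -> u - l <= eps * E x.
Proof.
move=> clu /andP[lx xu]; have [_ _ lu _] := clu.
have [s [c [_ Ey]]] := cell_affine _ hF _ _ _ _ hE clu.
have hr : 0 <= (eps * s - 1) * u + (eps * c + l).
  apply: (affine_ge0_right _ _ l) => // y lyu.
  have [h _] := stochastic_err_le _ _ _ clu lyu.
  by move: h; rewrite Ey; [rewrite mulrDr mulrBl mulrA; lra|lra].
have hl : 0 <= (eps * s + 1) * l + (eps * c - u).
  apply: (affine_ge0_left _ _ _ u) => // y lyu.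
  have [_ h] := stochastic_err_le _ _ _ clu lyu.
  by move: h; rewrite Ey; [rewrite mulrDr mulrDl mulrA; lra|lra].
rewrite Ey; last by rewrite lx.
have [s0|s0] := leP 0 s.
  have : eps * s * l <= eps * s * x by rewrite ler_wpM2l// mulr_ge0// ltW.
  by move: hl; rewrite mulrDl mulrDr mulrA; lra.
have : eps * s * u <= eps * s * x by rewrite ler_wnM2l// mulr_ge0_le0// ltW.
by move: hr; rewrite mulrBl mulrDr mulrA; lra.
Qed.

Lemma stochastic_full l u : cell F l u ->
  (I g l u <= (K * eps ^+ k)%:E * I (fun x => E x ^+ k)%R l u)%E.
Proof.
move=> clu; have [_ _ lu _] := clu.
have [s [c [sm Ey]]] := cell_affine _ hF _ _ _ _ hE clu.
have [P' [dP _ iP]] := integral_affine_power k _ _ _ _ _ Ey.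
have [_ ->] := stochastic_integral_cell _ _ clu.
have [lel leu] := (lexx l, lexx u); have lu' := ltW lu.
rewrite (iP l u)// -EFinM lee_fin -[leRHS]mulrA ler_wpM2l//.
rewrite -ler_pdivrMl ?exprn_gt0//.
(* The right side is the increment of an antiderivative of the constant [((u - l) / eps) ^+ k], a
   pointwise lower bound for [E ^+ k]. *)
have -> : (eps ^+ k)^-1 * (u - l) ^+ k.+1 =
    ((((u - l) / eps) ^+ k) *: 'X).[u] - ((((u - l) / eps) ^+ k) *: 'X).[l].
  by rewrite !hornerZ !hornerX -mulrBr exprSr expr_div_n; ring.
apply: ler_deriv_poly => // x lxu.
rewrite derivZ derivX hornerZ hornerC mulr1 dP horner_exp.
rewrite hornerD hornerZ hornerX hornerC -Ey//.
rewrite lerXn2r ?nnegrE// ?divr_ge0 ?subr_ge0// ?(ltW eps0)//.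
by rewrite ler_pdivrMr// mulrC stochastic_cell_le.
Qed.

(** The integral is enlarged to the whole cell, whose length [eps * E x] bounds at every point [x];
    hence no factor [beta] appears. *)
Lemma stochastic_partial l u x a b : cell F l u -> l <= x <= u -> l <= a -> b <= u ->
  (I g a b <= (K * E x ^+ k.+1 * eps ^+ k.+1)%:E)%E.
Proof.
move=> clu lxu la bu; have [_ _ lu _] := clu.
have [mg ig] := stochastic_integral_cell _ _ clu.
apply: (@le_trans _ _ (I g l u)).
  by apply: ge0_integral_itv_le => //; exact: stochastic_moment_ge0.
rewrite ig lee_fin -mulrA -exprMn ler_wpM2l// mulrC.
by rewrite lerXn2r ?nnegrE ?mulr_ge0 ?subr_ge0 ?(ltW eps0) ?(ltW lu)// stochastic_cell_le.
Qed.

End Expectation.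
End Stochastic.

Theorem theorem3 (R : realType) (F : set R) (hF : rounding_set F)
    (k : nat) (hk : (0 < k)%N) (eps : R) (heps : 0 < eps)
    (E : R -> R) (hE0 : forall x : R, 0 <= E x)
    (m : R) (hE : piecewise_linear_on F E m)
    (a b : R) (hab : a < b) :
  ((forall x : R, `|round_nearest F x - x| <= eps * E x) ->
   m * eps < 1 ->
   let beta : R := 1 / (1 - m * eps) in
   (`| \int[lebesgue_measure]_(x in `[a, b])
         (`|round_nearest F x - x| ^+ k)%:E |
    <= ((k.+1%:R : R)^-1)%:E
         * (\int[lebesgue_measure]_(x in `[a, b]) (E x ^+ k)%:E)
         * (eps ^+ k)%:E
       + (2 / k.+1%:R * ((beta * E a) ^+ k.+1 + (beta * E b) ^+ k.+1)
          * eps ^+ k.+1)%:E)%E)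
  /\
  (forall (d : measure_display) (Omega : measurableType d)
      (P : probability Omega R) (rd : R -> {RV P >-> R}),
   stochastic_rounding F rd ->
   (forall x v : R, (0 < P [set w | rd x w = v])%E ->
      `|v - x| <= eps * E x) ->
   (`| \int[lebesgue_measure]_(x in `[a, b])
         'E_P[fun w => (`|rd x w - x| ^+ k)%R] |
    <= (2 / (k ^ 2 + 3 * k + 2)%:R : R)%:E
         * (\int[lebesgue_measure]_(x in `[a, b]) (E x ^+ k)%:E)
         * (eps ^+ k)%:E
       + (2 / (k ^ 2 + 3 * k + 2)%:R * (E a ^+ k.+1 + E b ^+ k.+1)
          * eps ^+ k.+1)%:E)%E).
Proof.
have abs_integral (h : R -> R) : (forall x, 0 <= h x) ->
    (`|\int[lebesgue_measure]_(x in `[a, b]) (h x)%:E| =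
     \int[lebesgue_measure]_(x in `[a, b]) (h x)%:E)%E.
  by move=> h0; apply: gee0_abs; apply: integral_ge0 => x _; rewrite lee_fin.
have E0k x : 0 <= E x ^+ k by rewrite exprn_ge0.
have epsk n : 0 <= eps ^+ n by rewrite exprn_ge0// ltW.
have mE l u : cell F l u -> measurable_fun `[l, u] (EFin \o (fun x => E x ^+ k)).
  move=> clu; have [s [c [_ Ey]]] := cell_affine _ hF _ _ _ _ hE clu.
  by have [P []] := integral_affine_power k _ _ _ _ _ Ey.
split.
  move=> err_le meps1; cbv zeta; set beta := 1 / (1 - m * eps).
  have beta0 : 0 <= beta by rewrite divr_ge0// subr_ge0 ltW.
  have g0 x : 0 <= `|round_nearest F x - x| ^+ k by rewrite exprn_ge0.
  have A0 x : 0 <= 2 / k.+1%:R * (beta * E x) ^+ k.+1 * eps ^+ k.+1.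
    by rewrite mulr_ge0// mulr_ge0 ?divr_ge0// exprn_ge0// mulr_ge0.
  rewrite abs_integral// muleAC -EFinM mulrDr mulrDl.
  apply: (cover_integral_le _ hF) => //.
  - by move=> l u /(nearest_integral_cell _ k hF)[].
  - by rewrite mulr_ge0// invr_ge0.
  - move=> l u; exact: (nearest_full _ _ _ _ _ hF hE0 hE).
  - exact: ltW.
  - move=> l u; exact: (nearest_left _ _ _ _ _ hF hE0 hE).
  - move=> l u; exact: (nearest_right _ _ _ _ _ hF hE0 hE).
move=> d Omega P rd hrd err_le.
have K0 : 0 <= 2 / (k ^ 2 + 3 * k + 2)%:R :> R by rewrite divr_ge0.
have A0 x : 0 <= 2 / (k ^ 2 + 3 * k + 2)%:R * E x ^+ k.+1 * eps ^+ k.+1.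
  by rewrite mulr_ge0// mulr_ge0// exprn_ge0.
(* The expectation becomes an explicit function of [x]. *)
under eq_integral do rewrite (stochastic_momentE F k hF hk _ _ P rd hrd).
rewrite abs_integral; last exact: stochastic_moment_ge0.
rewrite muleAC -EFinM mulrDr mulrDl.
have CI0 l : (0 <= (2 / (k ^ 2 + 3 * k + 2)%:R * eps ^+ k)%:E *
    \int[lebesgue_measure]_(x in `[l, b]) (E x ^+ k)%:E)%E.
  apply: mule_ge0; first by rewrite lee_fin mulr_ge0.
  by apply: integral_ge0 => x _; rewrite lee_fin.
apply: (cover_integral_le _ hF) => //.
- exact: stochastic_moment_ge0.
- by move=> l u /(stochastic_integral_cell _ k hF hk)[].
- by rewrite mulr_ge0.
- move=> l u; exact: (stochastic_full _ _ hF hk _ _ P rd hrd _ _ _ hE0 hE heps).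
- exact: ltW.
- move=> l u clu /andP[la au].
  apply: (stochastic_partial _ _ hF hk _ _ P rd hrd _ _ _ hE0 hE heps err_le
    _ _ _ _ _ clu); lra.
(* The nonnegative integral term is dropped: the constant alone bounds the right remainder. *)
- move=> l u clu /andP[lb bu]; rewrite -[leLHS]add0e leeD//.
  apply: (stochastic_partial _ _ hF hk _ _ P rd hrd _ _ _ hE0 hE heps err_le
    _ _ _ _ _ clu); lra.
Qed.
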